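(* Let $\mathcal{G}$ be a minimal circular planar network with $n$ nodes, and let the $B$ variables be defined on the cells of its strand diagram (equivalently, on the vertices and faces of $\mathcal{G}$) as products of horizontal conductances: $B_C$ is the product of the horizontal conductances of all crossings whose left region contains the cell $C$. Then for every edge $e$ of $\mathcal{G}$ with conductance $c=c(e)$, $$c=\frac{B_vB_{v'}}{B_fB_{f'}},$$ where $v,v'$ are the endpoints of $e$ and $f,f'$ are the faces adjacent to $e$.
   Context: A circular planar network is a finite graph $\mathcal{G}=(V,E)$ embedded in a disk, with distinguished vertices $1,\dots,n$ (nodes) in cyclic order on the boundary of the disk, and a positive conductance $c(e)$ on each edge. Faces are the regions of the disk bounded by edges of $\mathcal{G}$ or by the boundary of the disk. The medial graph has a degree-4 vertex (a crossing) for every edge of $\mathcal{G}$, with crossings joined when the corresponding edges are consecutive around a face; near each node $i$ the medial edge separating it from the outside is broken into two half-edges called stubs, labelled $2i-1$ and $2i$, one on each side of node $i$, so that stubs $1,\dots,2n$ appear in cyclic order on the boundary of the disk. Strands are the paths in the medial graph that go straight through each crossing; they begin and end at stubs. The strand diagram is the collection of strands; the cells into which it divides the disk correspond to the vertices and faces of $\mathcal{G}$, and at the crossing of an edge $e$ the four cells around it are the two endpoints and the two adjacent faces of $e$. The network is minimal if it has the smallest number of edges in its topological equivalence class (networks related by removing dead branches and self-loops, series and parallel reductions, and Y-$\Delta$ moves, disregarding conductances); equivalently, there are no closed strands, no strand crosses itself, and any two strands cross at most once. Write each strand as $(i,j)$ with $i<j$ the labels of its end stubs. If two strands $(i_1,j_1)$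 and $(i_2,j_2)$ with $i_1<i_2<j_1<j_2$ cross, they divide the disk into four regions; the left region of the crossing is the one whose boundary contains the arc of the disk's boundary from stub $i_1$ to stub $i_2$, and the right region is the one whose boundary contains the arc from stub $j_1$ to stub $j_2$. The dual edge of an edge $e$ joins the two faces adjacent to $e$ and has conductance $1/c(e)$. The horizontal conductance of a crossing is the conductance $c(e)$ of the associated edge $e$ of $\mathcal{G}$ if the endpoints of $e$ lie in the left and right regions of the crossing, and otherwise is the conductance $1/c(e)$ of the dual edge. (An empty product is $1$.) *)

(* Defs.v *)
From HB Require Import structures.
From mathcomp Require Import all_boot all_order all_algebra all_fingroup.

Set Implicit Arguments.
Unset Strict Implicit.
Unset Printing Implicit Defensive.

Import GRing.Theory Num.Theory.
Local Open Scope ring_scope.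

(* A graph embedded in a disk is encoded by a combinatorial map.  An edge e has
   two half-edges inl (e, false) and inl (e, true), one at each endpoint.  The
   node i carries one extra half-edge, the "leg" inr i, which points from the
   node across the boundary of the disk.  A permutation rot lists the half-edges
   counterclockwise around every vertex; nodes are numbered 0, ..., n - 1
   counterclockwise along the boundary. *)
Definition halfedge (E : finType) (n : nat) : finType := ((E * bool) + 'I_n)%type.

Definition opp_fun (E : finType) (n : nat) (x : halfedge E n) : halfedge E n :=
  match x with
  | inl (e, b) => inl (e, ~~ b)
  | inr i => inr (ordS i)
  end.

Lemma opp_fun_inj (E : finType) (n : nat) : injective (@opp_fun E n).
Proof.
move=> [[e b]|i] [[e' b']|i'] //=; first by case=> -> /negb_inj ->.
by move=> eq_ij; congr inr; apply: ordS_inj; case: eq_ij => eq_ij; apply: val_inj.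
Qed.

(* The orbits of opp_perm are the edges and, if n > 0, the outside of the disk
   (the cycle of all legs). *)
Definition opp_perm (E : finType) (n : nat) : {perm halfedge E n} :=
  perm (@opp_fun_inj E n).

(* x stands for the half-edge itself and also for the corner between x and
   rot x.  That corner lies on the left of x, and face_perm walks around the
   boundary of a face, keeping it on the left: go along x to its other end
   (for a leg: along the boundary of the disk to the next leg), then take the
   clockwise neighbour.  So the orbits of rot are the vertices of the graph and
   the orbits of face_perm are its faces in the disk. *)
Definition face_perm (E : finType) (n : nat) (rot : {perm halfedge E n}) :
  {perm halfedge E n} := (opp_perm E n * rot^-1)%g.

Definition incident (E : finType) (n : nat) (rot : {perm halfedge E n}) :
  rel (halfedge E n) := [rel x y | (y == rot x) || (y == opp_perm E n x)].

(* Euler's formula: every connected component has genus 0. *)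
Definition planar (E : finType) (n : nat) (rot : {perm halfedge E n}) : bool :=
  (#|porbits rot| + #|porbits (opp_perm E n)| + #|porbits (face_perm rot)| ==
   #|halfedge E n| + 2 * n_comp (incident rot) predT)%N.

Record network (R : realFieldType) (n : nat) := Network {
  edge : finType;
  cond : edge -> R;
  rot : {perm halfedge edge n};
  cond_gt0 : forall e : edge, 0 < cond e;
  nodes_distinct : forall i j : 'I_n, inr i \in porbit rot (inr j) -> i = j;
  network_planar : planar rot
}.

Definition corner (R : realFieldType) (n : nat) (G : network R n) : finType :=
  halfedge (edge G) n.

(* The cells of the strand diagram: inl is used for vertices and inr for faces
   (as sets of corners, a vertex and a face may coincide). *)
Definition cell (R : realFieldType) (n : nat) (G : network R n) : finType :=
  ({set corner G} + {set corner G})%type.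

Definition vertex_at (R : realFieldType) (n : nat) (G : network R n)
  (x : corner G) : cell G := inl (porbit (rot G) x).

Definition face_at (R : realFieldType) (n : nat) (G : network R n)
  (x : corner G) : cell G := inr (porbit (face_perm (rot G)) x).

(* The edges of the medial graph are the corners: the medial edge x cuts the
   corner between x and rot x, so it separates vertex_at x from face_at x.
   At the crossing of e, with d one of the half-edges of e and d' the other, the
   four medial edges are, in cyclic order, d, rot^-1 d, d', rot^-1 d'; a strand
   going straight through passes from d to d' or from rot^-1 d to rot^-1 d'. *)
Definition straight (R : realFieldType) (n : nat) (G : network R n) :
  rel (corner G) :=
  [rel x y | [exists e : edge G, exists b : bool,
     ((x == inl (e, b)) && (y == inl (e, ~~ b)))
     || ((x == (rot G)^-1%g (inl (e, b)))
         && (y == (rot G)^-1%g (inl (e, ~~ b))))]].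

Definition strand (R : realFieldType) (n : nat) (G : network R n)
  (x : corner G) : {set corner G} := [set y | connect (@straight R n G) x y].

Definition strand1 (R : realFieldType) (n : nat) (G : network R n)
  (e : edge G) : {set corner G} := strand (inl (e, false) : corner G).

Definition strand2 (R : realFieldType) (n : nat) (G : network R n)
  (e : edge G) : {set corner G} :=
  strand ((rot G)^-1%g (inl (e, false)) : corner G).

Lemma stub_node_proof (n : nat) (k : 'I_(n.*2)) : (k./2 < n)%N.
Proof. by rewrite ltn_half_double. Qed.

Definition stub_node (n : nat) (k : 'I_(n.*2)) : 'I_n :=
  Ordinal (stub_node_proof k).

(* The two stubs at node i (numbered from 0) are 2i, clockwise of the leg, and
   2i + 1, counterclockwise of it; they are the halves of the medial edge that
   the leg cuts.  stub k is the medial edge (stub half-edge) ending at stub k. *)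
Definition stub (R : realFieldType) (n : nat) (G : network R n)
  (k : 'I_(n.*2)) : corner G :=
  if odd k then inr (stub_node k) else (rot G)^-1%g (inr (stub_node k)).

(* The cell bordered by the arc of the boundary from stub k to the next stub:
   the node itself if k = 2i, the face following it if k = 2i + 1. *)
Definition arc_cell (R : realFieldType) (n : nat) (G : network R n)
  (k : 'I_(n.*2)) : cell G :=
  if odd k then face_at (inr (stub_node k) : corner G)
  else vertex_at (inr (stub_node k) : corner G).

Definition strand_ends (R : realFieldType) (n : nat) (G : network R n)
  (S : {set corner G}) (i j : 'I_(n.*2)) : bool :=
  [set k | stub G k \in S] == [set i; j].

Record minimal (R : realFieldType) (n : nat) (G : network R n) : Prop := Minimal {
  no_closed_strand : forall x : corner G, exists k, stub G k \in strand x;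
  no_self_crossing : forall e : edge G, strand1 e != strand2 e;
  cross_at_most_once : forall e e' : edge G,
    [set strand1 e; strand2 e] = [set strand1 e'; strand2 e'] -> e = e'
}.

(* Two cells are in the same region of the crossing of e if one can pass from
   one to the other without traversing the two strands that cross at e. *)
Definition adjacent_off (R : realFieldType) (n : nat) (G : network R n)
  (e : edge G) : rel (cell G) :=
  [rel C D | [exists x : corner G,
     [&& x \notin strand1 e, x \notin strand2 e &
         ((C == vertex_at x) && (D == face_at x))
         || ((C == face_at x) && (D == vertex_at x))]]].

Definition same_region (R : realFieldType) (n : nat) (G : network R n)
  (e : edge G) : rel (cell G) := connect (adjacent_off e).

(* The strands that cross at e are (i1, j1) and (i2, j2), i1 < i2 < j1 < j2. *)
Definition crossing_ends (R : realFieldType) (n : nat) (G : network R n)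
  (e : edge G) (i1 i2 j1 j2 : 'I_(n.*2)) : bool :=
  [&& (i1 < i2)%N, (i2 < j1)%N, (j1 < j2)%N &
      (strand_ends (strand1 e) i1 j1 && strand_ends (strand2 e) i2 j2)
      || (strand_ends (strand2 e) i1 j1 && strand_ends (strand1 e) i2 j2)].

(* C is in the region whose boundary contains the arc from stub a to stub b. *)
Definition beside_arc (R : realFieldType) (n : nat) (G : network R n)
  (e : edge G) (a b : 'I_(n.*2)) (C : cell G) : bool :=
  [forall k : 'I_(n.*2), (a <= k < b)%N ==> same_region e (arc_cell G k) C].

Definition left_region (R : realFieldType) (n : nat) (G : network R n)
  (e : edge G) : {set cell G} :=
  [set C | [exists i1, exists i2, exists j1, exists j2,
     crossing_ends e i1 i2 j1 j2 && beside_arc e i1 i2 C]].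

Definition right_region (R : realFieldType) (n : nat) (G : network R n)
  (e : edge G) : {set cell G} :=
  [set C | [exists i1, exists i2, exists j1, exists j2,
     crossing_ends e i1 i2 j1 j2 && beside_arc e j1 j2 C]].

Definition endpoint (R : realFieldType) (n : nat) (G : network R n)
  (e : edge G) (b : bool) : cell G := vertex_at (inl (e, b) : corner G).

Definition side_face (R : realFieldType) (n : nat) (G : network R n)
  (e : edge G) (b : bool) : cell G := face_at (inl (e, b) : corner G).

Definition horizontal_cond (R : realFieldType) (n : nat) (G : network R n)
  (e : edge G) : R :=
  if [exists b : bool, (endpoint e b \in left_region e)
                       && (endpoint e (~~ b) \in right_region e)]
  then cond e else (cond e)^-1.

Definition B (R : realFieldType) (n : nat) (G : network R n) (C : cell G) : R :=
  \prod_(e : edge G | C \in left_region e) horizontal_cond e.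

(* Main.v *)
From mathcomp Require Import all_boot all_order all_algebra all_fingroup zify.
Require Import Defs.

(** Fix the edge e and look at the factor that the crossing of an edge d
    contributes to B_v B_v' / (B_f B_f').

    If d is not e, then by minimality one of the two strands through the crossing
    of e is not a strand through the crossing of d.  Along that strand, near e,
    each endpoint of e is separated from one of the two faces only by a medial edge
    that lies on neither strand of d.  So v, v' lie in the same regions of d as
    f, f', in some order, and the factor of d is 1 ([cells_paired]).

    If d = e, the four cells lie in the four different regions of the crossing.
    Exactly one of them is in the left region; the cell opposite to it is in the
    right region.  If the left cell is an endpoint, the horizontal conductance is
    c and appears in the numerator; if it is a face, the horizontal conductance
    is 1/c and appears in the denominator.  The factor is c in both cases
    ([crossing_factor]).

    The topology sits in the claim about the four regions, and has two sources.

    Planarity.  Take the vertices and faces of the network as vertices, its corners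
    as edges, and its edges together with the outside of the disk as 2-cells.  This
    is a closed surface, and Euler's formula says that its Euler characteristic is
    twice its number of components.  A dimension count turns this into the vanishing of its first
    cohomology over F_2 ([planar_potential]).  The indicator of a strand with two
    ends is a cocycle, so the cells can be coloured with two colours that change
    exactly across the strand ([strand_coloring]): a strand has two sides.  With
    the colourings of both strands through e the four cells around e get the four
    possible pairs of colours ([color_cells]), and cells of the same region get
    the same pair ([coloring_region]).

    Rays.  Cut the two strands of e at their crossing.  Following straight moves
    and turning around gives a dihedral action on the ends of medial edges, whose
    orbits are paths or cycles; so each of the four rays leaving e ends in a stub
    of its own ([two_ends]).  Along a ray the cells on its two sides stay in
    their regions ([ray_sides]), because the strands that are met on the way
    differ from both strands of e.  Hence the cells at the four stubs lie in the
    regions of the four cells around e, and reading their colours along the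
    boundary of the disk shows that the ends of the two strands alternate and
    that the left and the right region are opposite ([crossing_arcs]). *)

Set Implicit Arguments.
Unset Strict Implicit.
Unset Printing Implicit Defensive.

Import GRing.Theory Num.Theory.
Local Open Scope ring_scope.

(** * Exactness from a dimension count *)

Section DimensionCount.
Variable F : fieldType.

(** The columns of E are c further equations that cut the left kernel of A down
    to 0, so that kernel has dimension at most c. *)
Lemma rank_lower_bound (m n c : nat) (A : 'M[F]_(m, n)) (E : 'M[F]_(m, c)) :
  (forall u : 'rV_m, u *m A = 0 -> u *m E = 0 -> u = 0) ->
  (m <= \rank A + c)%N.
Proof.
move=> AE0; have: row_free (row_mx A E).
  rewrite -kermx_eq0 -submx0; apply/row_subP => i; rewrite submx0; apply/eqP.
  have: row i (kermx (row_mx A E)) *m row_mx A E = 0.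
    by rewrite -row_mul mulmx_ker row0.
  by rewrite mul_mx_row -row_mx0 => /eq_row_mx [uA uE]; apply: AE0.
rewrite /row_free -mxrank_tr tr_row_mx -addsmxE => /eqP rank_m.
rewrite -[leqLHS]rank_m (leq_trans (mxrank_adds_leqif _ _)) //.
by rewrite !mxrank_tr leq_add2l rank_leq_col.
Qed.

(** Exactness in the middle of F^P -> F^T -> F^O, where the first map and the
    transpose of the second have kernels of dimension at most c, each cut out by
    evaluation at c points.  The ranks then add up to at least
    (#|P| - c) + (#|O| - c) >= #|T|, which leaves no room for cohomology. *)
Lemma exact_of_card (P T O : finType) (c : nat)
    (a : P -> T -> F) (b : T -> O -> F) (eP : 'I_c -> P) (eO : 'I_c -> O) :
  (forall p o, \sum_t a p t * b t o = 0) ->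
  (forall u : P -> F, (forall t, \sum_p u p * a p t = 0) ->
     (forall k, u (eP k) = 0) -> forall p, u p = 0) ->
  (forall u : O -> F, (forall t, \sum_o u o * b t o = 0) ->
     (forall k, u (eO k) = 0) -> forall o, u o = 0) ->
  (#|T| + 2 * c <= #|P| + #|O|)%N ->
  forall w : T -> F, (forall o, \sum_t w t * b t o = 0) ->
  exists u : P -> F, forall t, w t = \sum_p u p * a p t.
Proof.
move=> ab0 injP injO leTPO w wb0.
pose A := \matrix_(i < #|P|, j < #|T|) a (enum_val i) (enum_val j).
pose Bm := \matrix_(i < #|T|, j < #|O|) b (enum_val i) (enum_val j).
pose ev (Q : finType) (f : 'I_c -> Q) :=
  \matrix_(i < #|Q|, k < c) (enum_val i == f k)%:R : 'M[F]_(#|Q|, c).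
have evE (Q : finType) (f : 'I_c -> Q) (u : 'rV[F]_#|Q|) k :
    (u *m ev Q f) 0 k = u 0 (enum_rank (f k)).
  rewrite mxE (bigD1 (enum_rank (f k))) //= big1 ?addr0 ?mxE ?enum_rankK ?eqxx ?mulr1 //.
  move=> i neq; rewrite mxE (_ : _ == _ = false) ?mulr0 //.
  by apply: contraNF neq => /eqP <-; rewrite enum_valK.
have sumE (Q : finType) (g : Q -> F) : \sum_(i < #|Q|) g (enum_val i) = \sum_q g q.
  by rewrite (big_enum_val (fun q : Q => g q)) //=.
have rA : (#|P| <= \rank A + c)%N.
  apply: (@rank_lower_bound _ _ _ A (ev P eP)) => u uA uE.
  apply/rowP => i; rewrite mxE -[i]enum_valK.
  apply: (injP (fun p => u 0 (enum_rank p))) => [t|k]; last by rewrite -evE uE mxE.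
  have /rowP /(_ (enum_rank t)) := uA; rewrite !mxE => uA0.
  by rewrite -[RHS]uA0 -[LHS]sumE; apply: eq_bigr => j _; rewrite mxE enum_valK enum_rankK.
have rB : (#|O| <= \rank Bm + c)%N.
  rewrite -mxrank_tr.
  apply: (@rank_lower_bound _ _ _ _ (ev O eO)) => u uB uE.
  apply/rowP => i; rewrite mxE -[i]enum_valK.
  apply: (injO (fun p => u 0 (enum_rank p))) => [t|k]; last by rewrite -evE uE mxE.
  have /rowP /(_ (enum_rank t)) := uB; rewrite !mxE => uA0.
  by rewrite -[RHS]uA0 -[LHS]sumE; apply: eq_bigr => j _; rewrite !mxE enum_valK enum_rankK.
have AB0 : A *m Bm = 0.
  apply/matrixP => i j; rewrite !mxE -[RHS](ab0 (enum_val i) (enum_val j)) -[RHS]sumE.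
  by apply: eq_bigr => k _; rewrite !mxE.
pose wv := \row_(j < #|T|) w (enum_val j).
have: (wv <= A)%MS.
  apply: (@submx_trans _ _ _ _ _ _ (kermx Bm)).
    apply/sub_kermxP/rowP => j; rewrite !mxE -[RHS](wb0 (enum_val j)) -[RHS]sumE.
    by apply: eq_bigr => k _; rewrite !mxE.
  have sAk : (A <= kermx Bm)%MS by apply/sub_kermxP.
  rewrite -(geq_leqif (mxrank_leqif_sup sAk)) mxrank_ker leq_subLR.
  rewrite -(leq_add2r (2 * c)%N) (leq_trans leTPO) //.
  by rewrite mul2n -addnn addnACA [leqRHS]addnC leq_add.
case/submxP => u wuA; exists (fun p => u 0 (enum_rank p)) => t.
have /rowP /(_ (enum_rank t)) := wuA; rewrite !mxE enum_rankK => ->.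
by rewrite -[RHS]sumE; apply: eq_bigr => j _; rewrite mxE enum_valK enum_rankK.
Qed.
End DimensionCount.

(** * Fixed points in the orbits of a dihedral action *)

Section Dihedral.
Variables (X : finType) (f m : X -> X).
Hypotheses (fK : involutive f) (mK : involutive m) (f_free : forall x, f x != x).

(** Its connected components are the orbits of the group generated by f and m,
    which is dihedral when both are involutions. *)
Definition dihedral : rel X := [rel x y | (y == f x) || (y == m x)].

Lemma dihedral_sym : connect_sym dihedral.
Proof.
apply: sym_connect_sym => x y /=.
by rewrite /dihedral /= eq_sym (inv_eq fK) [y == m x]eq_sym (inv_eq mK).
Qed.

(** If m fixes x, the orbit of x is a path that starts at x: it lists as
    s^0 x, s^1 x, ... with s = f o m, and m acts on this list as i -> - i, f as
    i -> 1 - i modulo the length p.  As f has no fixed point, p is even, and m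
    fixes exactly the indices 0 and p/2. *)
Lemma dihedral_other_end x : m x = x -> exists y, [/\ y != x, m y = y, connect dihedral x y &
  forall z, connect dihedral x z -> m z = z -> z = x \/ z = y].
Proof.
move=> mx; pose s := perm (inj_comp (inv_inj fK) (inv_inj mK)).
have sE z : s z = f (m z) by rewrite permE.
pose p := #|porbit s x|.
have p_gt0 : (0 < p)%N by rewrite lt0n card_porbit_neq0.
have spx : iter p s x = x by rewrite iter_porbit.
have iter_inj i j : (i < p)%N -> (j < p)%N -> iter i s x = iter j s x -> i = j.
  move=> ip jp eq_ij; apply/eqP.
  rewrite -(nth_uniq x _ _ (uniq_traject_porbit s x)) ?size_traject //.
  by rewrite !nth_traject // eq_ij.
have iter_m i j : (i + j = p)%N -> m (iter i s x) = iter j s x.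
  elim: i j => [|i IHi] j; first by rewrite add0n => ->; rewrite spx.
  move=> eq_ij; have := IHi j.+1; rewrite addnS -addSn => /(_ eq_ij) /= => mE.
  apply: (inv_inj mK); rewrite mK /= sE mE sE fK; done.
have iter_f i j : (i + j = p.+1)%N -> f (iter i s x) = iter j s x.
  case: j => [|j].
    by rewrite addn0 => ->; rewrite iterS spx sE fK mx.
  by rewrite addnS => -[/iter_m eq_ij]; rewrite iterS sE -eq_ij mK.
have in_orbit z : connect dihedral x z -> exists2 i, (i <= p)%N & z = iter i s x.
  case/connectP => q + ->; elim/last_ind: q => [|q y IHq]; first by exists 0%N.
  rewrite rcons_path last_rcons => /andP [/IHq {IHq} [i ip ->]] /orP [] /eqP ->.
    case: i ip => [|i] ip; first by exists 1%N; rewrite //= sE mx.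
    by exists (p - i)%N; rewrite ?leq_subr //; apply: iter_f; rewrite addSn subnKC // ltnW.
  by exists (p - i)%N; rewrite ?leq_subr //; apply: iter_m; rewrite subnKC.
have p_even : p = p./2.*2.
  have [odd_p|/even_halfK //] := boolP (odd p).
  have: f (iter p./2.+1 s x) = iter p./2.+1 s x.
    by apply: iter_f; rewrite addnS addSn addnn -[in RHS](odd_double_half p) odd_p.
  by move/eqP; rewrite (negPf (f_free _)).
have half_gt0 : (0 < p./2)%N by rewrite -double_gt0 -p_even.
have half_lt : (p./2 < p)%N by rewrite [ltnRHS]p_even -addnn -[ltnLHS]addn0 ltn_add2l.
exists (iter p./2 s x); split.
- apply: contraTneq half_gt0 => eq_x.
  by rewrite (iter_inj p./2 0%N) // -leqNgt.
- by apply: iter_m; rewrite addnn -p_even.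
- elim: (p./2) => //= i IHi; rewrite sE (connect_trans IHi) //.
  apply: (@connect_trans _ _ (m (iter i s x))); apply: connect1; rewrite /dihedral /= eqxx ?orbT //.
move=> z /in_orbit [i]; rewrite leq_eqVlt => /predU1P [-> ->|ip ->]; first by left.
case: i ip => [|i] ip; first by left.
rewrite (iter_m _ (p - i.+1)%N) ?subnKC ?(ltnW ip) // => eq_i.
have ii : (p - i.+1)%N = i.+1 by apply: iter_inj; rewrite ?ltn_subrL.
by right; rewrite -[in RHS](subnK (ltnW ip)) ii addnn doubleK.
Qed.
End Dihedral.

(** * Vanishing cohomology of a planar map *)

Definition orbits (T : finType) (s : {perm T}) : finType :=
  {X : {set T} | X \in porbits s}.

Fact porbit_in_porbits (T : finType) (s : {perm T}) (x : T) :
  porbit s x \in porbits s.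
Proof. exact: imset_f. Qed.

Definition orbit_of (T : finType) (s : {perm T}) (x : T) : orbits s :=
  exist _ (porbit s x) (porbit_in_porbits s x).

Lemma orbit_of_eq (T : finType) (s : {perm T}) (x y : T) :
  (orbit_of s x == orbit_of s y) = (x \in porbit s y).
Proof. by rewrite -val_eqE /= eq_porbit_mem. Qed.

Lemma orbit_of_perm (T : finType) (s : {perm T}) (x : T) :
  orbit_of s (s x) = orbit_of s x.
Proof. by apply/eqP; rewrite orbit_of_eq (mem_porbit s 1 x). Qed.

Lemma orbit_of_surj (T : finType) (s : {perm T}) (X : orbits s) :
  exists x, X = orbit_of s x.
Proof. by case: X => X /[dup] /imsetP [x _ eqX] pX; exists x; apply: val_inj. Qed.

Lemma card_orbits (T : finType) (s : {perm T}) : #|orbits s| = #|porbits s|.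
Proof. by rewrite card_sig; apply: eq_card. Qed.

Lemma incident_sym (E : finType) (n : nat) (rot : {perm halfedge E n}) :
  connect_sym (incident rot).
Proof.
have eq_rel : relU (frel rot) (frel (opp_perm E n)) =2 incident rot.
  by move=> u z; rewrite /incident /= ![_ == z]eq_sym.
move=> x y; rewrite -!(eq_connect eq_rel); apply: relU_sym; exact/fconnect_sym/perm_inj.
Qed.

Lemma invariant_eq0 (E : finType) (n : nat) (rot : {perm halfedge E n}) (A : nmodType)
  (psi : halfedge E n -> A) :
  (forall x, psi (rot x) = psi x) -> (forall x, psi (opp_perm E n x) = psi x) ->
  (forall x, x \in roots (incident rot) -> psi x = 0) -> forall x, psi x = 0.
Proof.
move=> psi_rot psi_opp psi0 x.
have psi_conn y : connect (incident rot) x y -> psi y = psi x.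
  case/connectP => q + ->; elim/last_ind: q => // q z IHq.
  by rewrite rcons_path last_rcons => /andP [/IHq <- /orP []] /eqP ->.
rewrite -(psi_conn _ (connect_root _ x)); apply/psi0.
by apply: roots_root; apply: incident_sym.
Qed.

(** Cellular cohomology of a closed surface.  Its edges are the elements of T; the
    edge x joins the vertices v x and c x, and borders the
    2-cells q x and q (rot x).  The points r i represent the components.  The
    cardinality hypothesis is Euler's formula for genus 0, and the conclusion
    is that a 1-cocycle w is a coboundary.  In characteristic 2 orientations can
    be ignored. *)
Lemma cochain_exact (F : fieldType) (T V C Q : finType) (rot opp : {perm T})
    (v : T -> V) (c : T -> C) (q : T -> Q) (k : nat) (r : 'I_k -> T) :
  (forall y : F, y + y = 0) ->
  (forall X, exists x, X = v x) -> (forall X, exists x, X = c x) ->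
  (forall X, exists x, X = q x) ->
  (forall x, v (rot x) = v x) -> (forall x, q (opp x) = q x) ->
  (forall x, c (rot^-1%g x) = c (opp^-1%g x)) ->
  (forall psi : T -> F, (forall x, psi (rot x) = psi x) ->
     (forall x, psi (opp x) = psi x) -> (forall i, psi (r i) = 0) ->
     forall x, psi x = 0) ->
  (#|T| + 2 * k <= #|V| + #|C| + #|Q|)%N ->
  forall w : T -> F,
  (forall X, \sum_(x | X == q x) (w x + w (rot^-1%g x)) = 0) ->
  exists g f, forall x, w x = g (v x) + f (c x).
Proof.
move=> addrr2 v_surj c_surj q_surj v_rot q_opp c_rot psi_eq0 leT w closed_w.
pose a (p : V + C) (x : T) : F :=
  match p with inl X => (X == v x)%:R | inr X => (X == c x)%:R end.
pose b (x : T) (X : Q) : F := ((X == q x) + (X == q (rot x)))%:R.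
have v_rotV x : v (rot^-1%g x) = v x by rewrite -v_rot permKV.
have sum_pick (I : finType) (u : I -> F) i : \sum_j u j * (j == i)%:R = u i.
  rewrite (bigD1 i) //= eqxx mulr1 big1 ?addr0 // => j /negPf ->.
  by rewrite mulr0.
have sum_a u x : \sum_p u p * a p x = u (inl (v x)) + u (inr (c x)).
  rewrite big_sumType /=.
  by rewrite (sum_pick V (fun X => u (inl X))) (sum_pick C (fun X => u (inr X))).
have sum_b u x : \sum_X u X * b x X = u (q x) + u (q (rot x)).
  under eq_bigr do rewrite /b natrD mulrDr.
  by rewrite big_split /= !sum_pick.
have sum_w (u : T -> F) X :
    \sum_x u x * b x X = \sum_(x | X == q x) (u x + u (rot^-1%g x)).
  under eq_bigr do rewrite /b natrD mulrDr.
  rewrite !big_split /=; congr (_ + _).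
    rewrite [RHS]big_mkcond; apply: eq_bigr => x _.
    by case: eqP => _; rewrite ?mulr1 ?mulr0.
  rewrite (reindex_inj (@perm_inj _ (rot^-1)%g)) [RHS]big_mkcond /=.
  apply: eq_bigr => x _.
  by rewrite permKV; case: eqP => _; rewrite ?mulr1 ?mulr0.
have sum_opp (u : T -> F) X :
    \sum_(x | X == q x) u (opp^-1%g x) = \sum_(x | X == q x) u x.
  rewrite (reindex_inj (@perm_inj _ opp)) /=.
  by apply: eq_big => x; rewrite ?q_opp // permK.
have eq_of_add0 (y z : F) : y + z = 0 -> y = z.
  by move=> yz; rewrite -[y]addr0 -(addrr2 z) addrA yz add0r.
have [u wE] : exists u : V + C -> F, forall x, w x = \sum_p u p * a p x.
  apply: (@exact_of_card _ (V + C)%type T Q k a b (fun i => inl (v (r i)))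
    (fun i => q (r i))).
  - move=> p X; rewrite sum_w big_split /=.
    case: p => Y /=.
      by under [X in _ + X]eq_bigr do rewrite v_rotV; rewrite addrr2.
    under [X in _ + X]eq_bigr do rewrite c_rot.
    by rewrite (sum_opp (fun x => (Y == c x)%:R)) addrr2.
  - move=> u ua0 u0.
    have uE x : u (inl (v x)) = u (inr (c x)) by apply: eq_of_add0; rewrite -sum_a.
    have uv0 : forall x, u (inl (v x)) = 0.
      apply: psi_eq0 => [x|x|i]; [by rewrite v_rot | | exact: u0].
      by rewrite -v_rotV uE c_rot permK uE.
    case=> X; first by case: (v_surj X) => x ->.
    by case: (c_surj X) => x ->; rewrite -uE.
  - move=> u ub0 u0.
    have uE x : u (q x) = u (q (rot x)) by apply: eq_of_add0; rewrite -sum_b.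
    have uq0 : forall x, u (q x) = 0.
      by apply: psi_eq0 => [x|x|i]; rewrite ?q_opp -?uE.
    by move=> X; case: (q_surj X) => x ->.
  - by rewrite card_sum.
  - by move=> X; rewrite sum_w.
by exists (u \o inl), (u \o inr) => x; rewrite wE sum_a.
Qed.

(** The surface of [cochain_exact] with the corners as edges: a corner joins its
    vertex to its face, and the orbits of opp_perm are the 2-cells, namely a
    quadrilateral around each crossing and, if there are nodes, a polygon outside
    the disk. *)
Lemma planar_potential (F : fieldType) (E : finType) (n : nat)
    (rot : {perm halfedge E n}) (w : halfedge E n -> F) :
  (forall y : F, y + y = 0) -> planar rot ->
  (forall h, \sum_(x in porbit (opp_perm E n) h) (w x + w (rot^-1%g x)) = 0) ->
  exists g f : {set halfedge E n} -> F,
    forall x, w x = g (porbit rot x) + f (porbit (face_perm rot) x).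
Proof.
move=> addrr2 planar_rot closed_w.
set opp := opp_perm E n in closed_w *; set face := face_perm rot.
pose c := #|[predI roots (incident rot) & predT]|.
have faceE x : face (opp^-1%g x) = rot^-1%g x by rewrite permM permKV.
have [g [f wE]] : exists g f, forall x, w x = g (orbit_of rot x) + f (orbit_of face x).
  apply: (@cochain_exact F _ _ _ _ rot opp _ _ (orbit_of opp) c enum_val) => //;
    try exact: orbit_of_surj; try exact: orbit_of_perm.
  - by move=> x; rewrite -faceE orbit_of_perm.
  - move=> psi psi_rot psi_opp psi0; apply: (invariant_eq0 (rot := rot)) => // x rx.
    have xc : x \in [predI roots (incident rot) & predT] by rewrite inE /= rx.
    by rewrite -(enum_rankK_in xc xc) psi0.
  - by rewrite !card_orbits; move: planar_rot => /eqP <-; rewrite addnAC.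
  - move=> X; case: (orbit_of_surj X) => h ->; rewrite -[RHS](closed_w h).
    by apply: eq_bigl => x; rewrite eq_sym orbit_of_eq.
(* Any value will do on the sets that are not orbits. *)
pose extend (s : {perm halfedge E n}) (u : orbits s -> F) X := oapp u 0 (insub X).
have insubE (s : {perm halfedge E n}) y : insub (porbit s y) = Some (orbit_of s y).
  by rewrite -[porbit s y]/(val (orbit_of s y)) valK.
by exists (extend _ g), (extend _ f) => x; rewrite /extend !insubE wE.
Qed.

Lemma planar_coloring (E : finType) (n : nat) (rot : {perm halfedge E n})
    (w : pred (halfedge E n)) :
  planar rot ->
  (forall h, ~~ odd (\sum_(x in porbit (opp_perm E n) h) (w x + w (rot^-1%g x)))) ->
  exists g f : {set halfedge E n} -> bool,
    forall x, g (porbit rot x) (+) f (porbit (face_perm rot) x) = w x.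
Proof.
move=> planar_rot even_w.
have natr2 k : k%:R = (odd k)%:R :> 'F_2.
  by apply: val_inj; rewrite /= !val_Fp_nat // modn2; case: (odd k).
have addrr2 (y : 'F_2) : y + y = 0.
  by rewrite -[y]natr_Zp -natrD addnn natr2 odd_double.
have [h|g [f wE]] := @planar_potential _ _ _ rot (fun x => (w x)%:R) addrr2 planar_rot.
  under eq_bigr do rewrite -natrD.
  by rewrite -natr_sum natr2 (negPf (even_w h)).
exists (fun X => g X != 0), (fun X => f X != 0) => x.
have boolE (y : 'F_2) : y = (y != 0)%:R by case: y => [[|[|//]] ?]; apply: val_inj.
have: (w x)%:R = ((g (porbit rot x) != 0) + (f (porbit (face_perm rot) x) != 0))%:R :> 'F_2.
  by rewrite wE natrD -!boolE.
move/(congr1 val); rewrite /= !val_Fp_nat // !modn2 oddD !oddb.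
by case: (w x); case: (_ (+) _).
Qed.

(** * Strands and the rays leaving a crossing *)

Section Strands.
Variables (R : realFieldType) (n : nat) (G : network R n).
Local Notation E := (edge G).
Local Notation T := (corner G).
Local Notation dart := (T * bool)%type.

(** A dart (h, b) is one of the two ends of medial edges at the half-edge h: the
    one in the corner before h (b = true) or after h (b = false).  At an edge these
    are the ends at its crossing, and at a leg they are the stubs. *)
Definition medial (t : dart) : T := if t.2 then (rot G)^-1%g t.1 else t.1.

Definition other_half (t : dart) : dart :=
  (if t.2 then (rot G)^-1%g t.1 else rot G t.1, ~~ t.2).

(** Going straight through the crossing at which a dart ends, except for the
    crossing of e, where one stays, and for the stubs, where the strand stops.  So
    the fixed points are the ends of the strands cut at the crossing of e. *)
Definition cross_off (e : E) (t : dart) : dart :=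
  match t.1 with
  | inl (e', s) => if e' == e then t else (inl (e', ~~ s), t.2)
  | inr _ => t
  end.

Definition off_rel (e : E) : rel dart := dihedral other_half (cross_off e).

Definition stub_dart (k : 'I_(n.*2)) : dart := (inr (stub_node k), ~~ odd k).

Lemma other_halfK : involutive other_half.
Proof. by case=> h [] /=; rewrite /other_half /= ?permK ?permKV. Qed.

Lemma other_half_free t : other_half t != t.
Proof. by case: t => h []; rewrite /other_half xpair_eqE andbF. Qed.

Lemma cross_offK e : involutive (cross_off e).
Proof.
case=> [[[e' s]|i] b] //=; rewrite /cross_off /=.
by have [->|/negPf ne] := eqVneq e' e; rewrite /= ?eqxx // ne negbK.
Qed.

Lemma medial_other_half t : medial (other_half t) = medial t.
Proof. by case: t => h []; rewrite /other_half /medial /= ?permK. Qed.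

Lemma eq_medial t u : medial t = medial u -> u = t \/ u = other_half t.
Proof.
case: t u => [h []] [h' []]; rewrite /medial /other_half /=.
- by move/perm_inj ->; left.
- by move=> <-; right.
- by move=> ->; rewrite permKV; right.
- by move=> ->; left.
Qed.

Lemma stub_medial k : stub G k = medial (stub_dart k).
Proof. by rewrite /stub /medial /stub_dart /=; case: (odd k). Qed.

Lemma half_end_lt (i : 'I_n) (b : bool) : (~~ b + i.*2 < n.*2)%N.
Proof. by case: b; rewrite ?ltn_double ?ltn_Sdouble. Qed.

Definition leg_end (u : 'I_n * bool) : 'I_(n.*2) := Ordinal (half_end_lt u.1 u.2).

Lemma stub_dart_end (i : 'I_n) (b : bool) : stub_dart (leg_end (i, b)) = (inr i, b).
Proof.
rewrite /stub_dart /= oddD odd_double addbF oddb negbK; congr (inr _, _).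
by apply: val_inj; rewrite /= half_bit_double.
Qed.

Lemma stub_dart_inj : injective stub_dart.
Proof.
move=> k k' [eq_half /negb_inj eq_odd]; apply: ord_inj.
by rewrite -[LHS]odd_double_half eq_odd eq_half odd_double_half.
Qed.

Lemma cross_off_fixed e t :
  cross_off e t = t -> (exists s, t.1 = inl (e, s)) \/ exists k, t = stub_dart k.
Proof.
case: t => [[[e' s]|i] b]; rewrite /cross_off /=; last first.
  by right; exists (leg_end (i, b)); rewrite stub_dart_end.
have [->|ne] := eqVneq e' e; first by left; exists s.
by case; case: s.
Qed.

Lemma cross_off_edge e s b : cross_off e (inl (e, s), b) = (inl (e, s), b).
Proof. by rewrite /cross_off /= eqxx. Qed.

Lemma cross_off_stub e k : cross_off e (stub_dart k) = stub_dart k.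
Proof. by []. Qed.

Lemma off_sym e : connect_sym (off_rel e).
Proof. exact: dihedral_sym other_halfK (cross_offK e). Qed.

Lemma straightP (x y : T) :
  reflect (exists e s b, x = medial (inl (e, s), b) /\ y = medial (inl (e, ~~ s), b))
          (straight x y).
Proof.
apply: (iffP idP) => [|[e [s [b [-> ->]]]]].
  case/existsP => e /existsP [s] /orP [] /andP [/eqP -> /eqP ->].
    by exists e, s, false.
  by exists e, s, true.
apply/existsP; exists e; apply/existsP; exists s.
by case: b; rewrite /medial /= !eqxx ?orbT.
Qed.

Lemma straight_sym : connect_sym (@straight R n G).
Proof.
apply: sym_connect_sym => x y.
by apply/straightP/straightP => -[e [s [b [-> ->]]]]; exists e, (~~ s), b; rewrite negbK.
Qed.

Lemma mem_strand (x y : T) : (y \in strand x) = (strand y == strand x).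
Proof.
rewrite inE; apply/idP/eqP => [xy|/setP /(_ y)]; last by rewrite !inE connect0.
by apply/setP => z; rewrite !inE (same_connect straight_sym xy).
Qed.

Lemma strand_straight (x y : T) : straight x y -> strand x = strand y.
Proof. by move=> xy; apply/eqP; rewrite -mem_strand inE straight_sym connect1. Qed.

Definition strand_at (e : E) (b : bool) : {set T} := strand (medial (inl (e, false), b)).

Lemma strand_atE e s b : strand (medial (inl (e, s), b)) = strand_at e b.
Proof.
case: s => //; apply/esym/strand_straight/straightP.
by exists e, false, b.
Qed.

Lemma strand_off e t u : connect (off_rel e) t u -> strand (medial t) = strand (medial u).
Proof.
case/connectP => q + ->; elim/last_ind: q => // q [h b] IHq.
rewrite rcons_path last_rcons => /andP [/IHq -> {IHq}] /orP [] /eqP ->.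
  by rewrite medial_other_half.
case: (last _ _) => [[[e' s]|i] b'] //; rewrite /cross_off /=.
by case: ifP => // _; rewrite !strand_atE.
Qed.

Section Minimal.
Hypothesis G_min : minimal G.
Variable e : E.
Local Notation conn := (connect (off_rel e)).

Lemma strand_at_neq e' b : strand_at e' b != strand_at e' (~~ b).
Proof. by case: b; first rewrite eq_sym; apply: (no_self_crossing G_min). Qed.

Lemma strand_at_inj e' b b' : strand_at e' b = strand_at e' b' -> b = b'.
Proof.
move=> eq_b; apply/eqP; apply: contraNT (strand_at_neq e' b) => ne_b.
by rewrite (_ : ~~ b = b') ?eq_b //; case: (b) (b') ne_b => -[].
Qed.

(** Every medial edge of a strand through e is met by one of the two rays that
    leave e along this strand: going straight either stays on the ray or
    passes through e, from one ray to the other. *)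
Lemma strand_covered b (x : T) : x \in strand_at e b ->
  exists t s, [/\ medial t = x & conn (inl (e, s), b) t].
Proof.
rewrite inE => /connectP [q + ->]; elim/last_ind: q => [|q y IHq].
  by exists (inl (e, false), b), false.
rewrite rcons_path last_rcons => /andP [/IHq [t [s [mt st]]]] /straightP.
case=> e' [s' [b' [mx ->]]]; rewrite {}mx in mt.
have {mt} st' : conn (inl (e, s), b) (inl (e', s'), b').
  case: (eq_medial mt) => -> //; apply: connect_trans st (connect1 _).
  by rewrite /off_rel /dihedral /= eqxx.
have [eq_e|ne] := eqVneq e' e; last first.
  exists (inl (e', ~~ s'), b'), s; split=> //; apply: connect_trans st' (connect1 _).
  by rewrite /off_rel /dihedral /= /cross_off /= (negPf ne) eqxx orbT.
move: st'; rewrite {}eq_e => /strand_off; rewrite !strand_atE => /strand_at_inj <-.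
by exists (inl (e, ~~ s'), b), (~~ s').
Qed.

Lemma stub_reached b k : stub G k \in strand_at e b ->
  exists s, conn (inl (e, s), b) (stub_dart k).
Proof.
rewrite stub_medial => /strand_covered [t [s [/eq_medial mt st]]]; exists s.
case: mt => -> //; apply: connect_trans st (connect1 _).
by rewrite /off_rel /dihedral /= eqxx.
Qed.

(** By [dihedral_other_end] the ray has one other end.  If this end were again at
    e, the two rays along this strand would be the same path and the strand would
    be closed, because neither would reach a stub. *)
Lemma ray_ends b s : exists k, conn (inl (e, s), b) (stub_dart k) /\
  forall t, conn (inl (e, s), b) t -> cross_off e t = t ->
    t = (inl (e, s), b) \/ t = stub_dart k.
Proof.
have [u [ut fu tu only_u]] :=
  dihedral_other_end other_halfK (cross_offK e) other_half_free (cross_off_edge e s b).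
have [[s' u1]|[k uk]] := cross_off_fixed fu; last by exists k; rewrite -uk.
case: u => [h b'] /= in ut fu tu only_u u1 *; rewrite {h}u1 in ut fu tu only_u.
have eq_b : b = b'.
  by apply: (@strand_at_inj e); rewrite -(strand_atE e s) -(strand_atE e s'); apply: strand_off tu.
rewrite -{b'}eq_b in ut fu tu only_u.
have eq_s : s' = ~~ s.
  apply/eqP; apply: contraNT ut => ne; apply/eqP; congr (inl (e, _), b).
  by case: (s) ne; case: (s').
have [k] := no_closed_strand G_min (medial (inl (e, false), b)).
case/stub_reached => s'' reach_k.
have /only_u : conn (inl (e, s), b) (stub_dart k).
  have [<- //|ne] := eqVneq s'' s; apply: connect_trans tu _.
  by rewrite eq_s (_ : ~~ s = s'') //; case: (s) ne; case: (s'').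
by case/(_ (cross_off_stub e k)).
Qed.

(** The two rays of e along the strand end in different stubs, since a ray has only
    two ends, and they reach all the stubs of the strand. *)
Lemma two_ends b : exists k : bool -> 'I_(n.*2),
  [/\ k false != k true, forall s, conn (inl (e, s), b) (stub_dart (k s)) &
      strand_ends (strand_at e b) (k false) (k true)].
Proof.
have [kF [connF onlyF]] := ray_ends b false.
have [kT [connT onlyT]] := ray_ends b true.
exists (fun s => if s then kT else kF); split=> [|[]//|].
  apply/eqP => eq_k; rewrite -{}eq_k in connT onlyT.
  have /onlyF [] // : conn (inl (e, false), b) (inl (e, true), b).
    by rewrite (connect_trans connF) // off_sym.
  by rewrite cross_off_edge.
apply/eqP/setP => k; rewrite in_set in_set2; apply/idP/orP => [/stub_reached [] []|].
- by move=> /onlyT [] // /stub_dart_inj ->; right.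
- by move=> /onlyF [] // /stub_dart_inj ->; left.
case=> /eqP ->; rewrite mem_strand stub_medial.
  by rewrite -(strand_off connF) strand_atE.
by rewrite -(strand_off connT) strand_atE.
Qed.
End Minimal.
End Strands.

(** * Cells along a strand and the two sides of a strand *)

Section Regions.
Variables (R : realFieldType) (n : nat) (G : network R n).
Local Notation E := (edge G).
Local Notation T := (corner G).
Local Notation opp := (opp_perm (edge G) n).

Lemma oppE (h : T) : opp h = opp_fun h.
Proof. exact: permE. Qed.

Lemma vertex_medial (t : T * bool) : vertex_at (medial t) = vertex_at t.1.
Proof.
case: t => h [] //; congr inl; apply/eqP; rewrite eq_porbit_mem.
by rewrite -[X in _ \in porbit _ X](permKV (rot G) h) porbit_sym (mem_porbit _ 1).
Qed.

Lemma face_rotV (h : T) : face_at ((rot G)^-1%g (opp h)) = face_at h.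
Proof.
congr inr; apply/eqP; rewrite eq_porbit_mem.
by have := mem_porbit (face_perm (rot G)) 1 h; rewrite permM.
Qed.

Lemma face_medial (e : E) (s b : bool) :
  face_at (medial (inl (e, s), b)) = side_face e (if b then ~~ s else s).
Proof.
case: b => //; rewrite -[RHS](face_rotV (inl (e, ~~ s))) /medial /=.
by rewrite oppE /= negbK.
Qed.

Lemma arc_cell_sides (k : 'I_(n.*2)) :
  arc_cell G k = vertex_at (stub G k) \/ arc_cell G k = face_at (stub G k).
Proof.
rewrite /arc_cell /stub; case: (odd k); first by right.
by left; rewrite -(vertex_medial (inr (stub_node k), true)).
Qed.

Lemma arc_cell_step (k k' : 'I_(n.*2)) : k' = k.+1 :> nat ->
  (arc_cell G k = vertex_at (stub G k') /\ arc_cell G k' = face_at (stub G k')) \/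
  (arc_cell G k = face_at (stub G k') /\ arc_cell G k' = vertex_at (stub G k')).
Proof.
move=> kk'; rewrite /arc_cell /stub kk' /=; have [odd_k|even_k] /= := boolP (odd k).
  right; rewrite -(vertex_medial (inr (stub_node k'), true)); split=> //.
  rewrite /medial /= -[LHS]face_rotV oppE /=; congr (face_at (_ (inr _))).
  apply: val_inj; rewrite /= kk' /= uphalf_half odd_k add1n modn_small //.
  have := ltn_ord (stub_node k').
  by rewrite /= kk' /= uphalf_half odd_k.
left; rewrite (_ : stub_node k' = stub_node k) //.
by apply: val_inj; rewrite /= kk' /= uphalf_half (negPf even_k).
Qed.

Lemma leg_orbit (i j : 'I_n) : (inr j : T) \in porbit opp (inr i).
Proof.
have n_gt0 : (0 < n)%N by apply: leq_ltn_trans (ltn_ord i).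
have iterE m : exists2 l : 'I_n, iter m opp (inr i) = inr l & l = ((i + m) %% n)%N :> nat.
  elim: m => [|m [l iE lE]]; first by exists i; rewrite // addn0 modn_small.
  exists (ordS l); first by rewrite iterS iE oppE.
  by rewrite /= lE -addn1 modnDml addn1 addnS.
have [l lE eq_l] := iterE (j + (n - i))%N.
rewrite (_ : j = l); first by rewrite -lE -permX mem_porbit.
apply: val_inj; rewrite /= eq_l addnCA subnKC ?modnDr ?modn_small //.
exact: ltnW.
Qed.

Lemma edge_orbit (e : E) (s : bool) : porbit opp (inl (e, s) : T) = [set inl (e, s); inl (e, ~~ s)].
Proof.
apply/setP => y; rewrite !inE; apply/porbitP/orP => [[i ->]|[] /eqP ->].
- elim: i => [|i [] /eqP IHi]; first by left; rewrite expg0 perm1.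
    by right; rewrite expgSr permM IHi oppE.
  by left; rewrite expgSr permM IHi oppE /= negbK.
- by exists 0%N; rewrite expg0 perm1.
- by exists 1%N; rewrite expg1 oppE.
Qed.

Lemma leg_orbitE i : porbit opp (inr i : T) = [set inr j | j in 'I_n].
Proof.
apply/setP => y; apply/idP/imsetP => [/porbitP [m ->]|[j _ ->]]; last exact: leg_orbit.
elim: m => [|m [j _ IHm]]; first by exists i; rewrite // expg0 perm1.
by exists (ordS j); rewrite // expgSr permM IHm oppE.
Qed.

(** The indicator of S is a cocycle: around a crossing the medial edges come in
    pairs that continue each other, and around the outside of the disk S is met once
    for each of its stubs. *)
Lemma strand_coloring (S : {set T}) :
  (forall (e : E) s b, (medial (inl (e, s), b) \in S) = (medial (inl (e, ~~ s), b) \in S)) ->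
  ~~ odd #|[set k | stub G k \in S]| ->
  exists chi : cell G -> bool, forall x, chi (vertex_at x) (+) chi (face_at x) = (x \in S).
Proof.
move=> S_straight S_even.
have [|g [f gfE]] := @planar_coloring _ _ (rot G) (mem S) (network_planar G).
  case=> [[e s]|i].
    rewrite edge_orbit big_setU1 ?big_set1 /=; last by rewrite inE; apply/eqP; case; case: (s).
    rewrite -(S_straight e s false) -(S_straight e s true) addnn odd_double //.
  rewrite leg_orbitE big_imset /=; last by move=> j j' _ _ [].
  suff -> : (\sum_(j in 'I_n) ((inr j \in S) + ((rot G)^-1%g (inr j) \in S)))%N =
    #|[set k | stub G k \in S]| :> nat by [].
  rewrite -sum1dep_card big_mkcond /=.
  rewrite (reindex (@leg_end n)) /=; last first.
    exists (fun k => (stub_node k, ~~ odd k)) => [[j b] _|k _].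
      have /= [-> ->] // := @stub_dart_end R n G j b.
    by apply: (@stub_dart_inj R n G); rewrite stub_dart_end.
  transitivity (\sum_(j < n) \sum_b (stub G (leg_end (j, b)) \in S))%N; last first.
    by rewrite pair_bigA [RHS]big_mkcond; apply: eq_bigr => -[j b] _ /=; case: (_ \in S).
  apply: eq_bigr => j _ /=.
  by rewrite big_bool /= !stub_medial !stub_dart_end /medial /= addnC.
by exists (fun C => match C with inl X => g X | inr X => f X end) => x; apply: gfE.
Qed.
End Regions.

(** * Moving inside a region *)

Section MinimalNetwork.
Variables (R : realFieldType) (n : nat) (G : network R n).
Hypothesis G_min : minimal G.
Local Notation E := (edge G).
Local Notation T := (corner G).

Lemma same_region_sym (e : E) : connect_sym (@adjacent_off R n G e).
Proof.
apply: sym_connect_sym => C D; apply/existsP/existsP => -[x /and3P [x1 x2 CD]];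
  by exists x; rewrite x1 x2; case/orP: CD => /andP [/eqP -> /eqP ->]; rewrite !eqxx ?orbT.
Qed.

Lemma same_region_trans (e : E) : transitive (@same_region R n G e).
Proof. exact: connect_trans. Qed.

Lemma same_region_corner (e : E) (x : T) :
  (forall b, x \notin strand_at e b) -> same_region e (vertex_at x) (face_at x).
Proof.
move=> xe; apply: connect1; apply/existsP; exists x.
by rewrite (xe false) (xe true) !eqxx.
Qed.

Lemma coloring_region (e : E) (b : bool) (chi : cell G -> bool) (C D : cell G) :
  (forall x, chi (vertex_at x) (+) chi (face_at x) = (x \in strand_at e b)) ->
  same_region e C D -> chi C = chi D.
Proof.
move=> chiE /connectP [q + ->]; elim/last_ind: q => // q D' IHq.
rewrite rcons_path last_rcons => /andP [/IHq -> {IHq}] /existsP [x /and3P [x1 x2 CD]].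
have : x \notin strand_at e b by case: b {chiE}.
by rewrite -chiE; case/orP: CD => /andP [/eqP -> /eqP ->]; case: (chi _); case: (chi _).
Qed.

Lemma mem_strand_at (e e' : E) s b b' :
  (medial (inl (e', s), b') \in strand_at e b) = (strand_at e' b' == strand_at e b).
Proof. by rewrite mem_strand strand_atE. Qed.

(** Otherwise e and e' would be crossings of the same two strands. *)
Lemma strand_at_not_both (e e' : E) b b' : e' != e ->
  strand_at e' b' = strand_at e b -> forall c, strand_at e' (~~ b') != strand_at e c.
Proof.
move=> ne eq_b c; apply: contraNneq ne => eq_c; apply/eqP.
have neq_bc : b != c.
  by apply: contraNneq (strand_at_neq G_min e' b') => eq_bc; rewrite eq_b eq_c eq_bc.
have pair_at (d : E) a : [set strand1 d; strand2 d] = [set strand_at d a; strand_at d (~~ a)].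
  by case: a; rewrite // setUC.
apply: (cross_at_most_once G_min); rewrite (pair_at e' b') (pair_at e b) eq_b eq_c.
by congr [set _; strand_at e _]; case: (b) (c) neq_bc => [] [].
Qed.

Lemma edge_cells_across (e e' : E) (b : bool) :
  (forall c, strand_at e' b != strand_at e c) ->
  forall s, same_region e (endpoint e' s) (side_face e' (if b then ~~ s else s)).
Proof.
move=> off_b s; rewrite -face_medial.
have -> : endpoint e' s = vertex_at (medial (inl (e', s), b)) by rewrite vertex_medial.
by apply: same_region_corner => c; rewrite mem_strand_at.
Qed.

(** One of the strands through e' is not a strand through e, by [strand_at_not_both];
    the medial edges of e' on it pair the endpoints of e' with the faces
    of e' inside regions of e. *)
Lemma cells_paired (e e' : E) : e' != e ->
  exists c, forall s, same_region e (endpoint e' s) (side_face e' (s (+) c)).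
Proof.
move=> ne; have [on|off] := boolP [exists b, strand_at e' false == strand_at e b].
  case/existsP: on => b /eqP eq_b.
  exists true => s; rewrite addbT.
  by apply: (edge_cells_across (b := true)); apply: (strand_at_not_both ne eq_b).
exists false => s; rewrite addbF.
by apply: (edge_cells_across (b := false)); apply/existsPn.
Qed.

(** Equality of the sides of two medial edges up to regions and without
    orientation.  This fixes the cyclic order of the four regions along the boundary
    only up to reversal, but a reversal preserves which regions are opposite. *)
Definition same_sides (e : E) (x y : T) :=
  (same_region e (vertex_at x) (vertex_at y) /\ same_region e (face_at x) (face_at y)) \/
  (same_region e (vertex_at x) (face_at y) /\ same_region e (face_at x) (vertex_at y)).

(** Going straight through a crossing e' other than e, the ray meets a strand
    which is not one of the two strands of e, so one passes from the side cells
    before e' to those after e' without leaving the regions of e.  A straight move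
    exchanges the roles of vertex and face. *)
Lemma ray_sides (e : E) s b t : connect (off_rel e) (inl (e, s), b) t ->
  same_sides e (medial (inl (e, s), b)) (medial t).
Proof.
case/connectP => q + ->; elim/last_ind: q => [|q y IHq].
  by left; split; apply: connect0.
rewrite rcons_path last_rcons => /andP [pq /orP [] /eqP ->].
  by rewrite medial_other_half; apply: IHq.
have /strand_off : connect (off_rel e) (inl (e, s), b) (last (inl (e, s), b) q).
  by apply/connectP; exists q.
case: (last _ _) (IHq pq) => [[[e' s']|i] b'] //= {pq IHq}; rewrite /cross_off /=.
case: eqP => [//|/eqP ne] sides; rewrite !strand_atE => /esym eq_b.
have cross u : same_region e (endpoint e' u) (side_face e' (if ~~ b' then ~~ u else u)).
  by apply: edge_cells_across; apply: strand_at_not_both ne eq_b.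
move: sides; rewrite /same_sides !vertex_medial !face_medial /=.
have := cross (~~ s'); have := cross s'; rewrite /= negbK /endpoint.
by case: b' {cross eq_b} => /= c1 c2; case; case=> h1 h2; [right|left|right|left]; split;
  (apply: same_region_trans h1 _ || apply: same_region_trans h2 _);
  rewrite // /same_region same_region_sym.
Qed.

Lemma strand_end_mem (e : E) b i j k :
  strand_ends (strand_at e b) i j -> (stub G k \in strand_at e b) = (k == i) || (k == j).
Proof. by move/eqP/setP/(_ k); rewrite in_set in_set2. Qed.

(** Consecutive cells of the boundary are separated by a stub, so the colour changes
    at the two ends of the strand only.  The constant p is the colour before stub i,
    even if i = 0 and no boundary cell comes before it. *)
Lemma arc_coloring (e : E) b (i j : 'I_(n.*2)) (chi : cell G -> bool) :
  strand_ends (strand_at e b) i j -> (i < j)%N ->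
  (forall x, chi (vertex_at x) (+) chi (face_at x) = (x \in strand_at e b)) ->
  exists p, forall k, chi (arc_cell G k) = p (+) (i <= k < j)%N.
Proof.
move=> ends ij chiE; have n_gt0 : (0 < n.*2)%N by apply: leq_ltn_trans (ltn_ord i).
pose k0 := Ordinal n_gt0; exists (chi (arc_cell G k0) (+) (i <= k0 < j)%N) => -[m].
elim: m => [|m IHm] lt_m; first by rewrite (_ : Ordinal lt_m = k0) ?addbK //; apply: val_inj.
have := IHm (ltnW lt_m); set k := Ordinal (ltnW lt_m); set k' := Ordinal lt_m => IHk.
have: chi (arc_cell G k) (+) chi (arc_cell G k') = (k' == i) || (k' == j).
  rewrite -(strand_end_mem _ ends) -chiE.
  by have [[-> ->]|[-> ->]] := @arc_cell_step R n G k k' erefl; rewrite // addbC.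
have -> : (k' == i) || (k' == j) = (i <= m < j)%N (+) (i <= m.+1 < j)%N.
  by rewrite -!val_eqE /=; clear -ij; lia.
move=> step; rewrite -[LHS](addKb (chi (arc_cell G k))) step {}IHk /=.
by rewrite -addbA addKb.
Qed.

Lemma arcs_region (e : E) (i k : 'I_(n.*2)) : (i <= k)%N ->
  (forall m : 'I_(n.*2), (i < m <= k)%N -> forall b, stub G m \notin strand_at e b) ->
  same_region e (arc_cell G i) (arc_cell G k).
Proof.
case: k => k; elim: k => [|k IHk] lt_k /= ik off.
  have -> : i = Ordinal lt_k by apply/val_inj/eqP; rewrite -leqn0.
  exact: connect0.
have [eq_ik|ne_ik] := eqVneq (nat_of_ord i) k.+1.
  have -> : i = Ordinal lt_k by apply: val_inj.
  exact: connect0.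
have {ne_ik} ik' : (i <= k)%N by rewrite -ltnS ltn_neqAle ne_ik.
apply: (@same_region_trans _ (arc_cell G (Ordinal (ltnW lt_k)))).
  by apply: IHk => //= m /andP [im mk]; apply: off; rewrite im leqW.
have := @same_region_corner e (stub G (Ordinal lt_k)).
have [[-> ->]|[-> ->]] := @arc_cell_step R n G (Ordinal (ltnW lt_k)) (Ordinal lt_k) erefl;
  rewrite /same_region 1?[connect _ (face_at _) _]same_region_sym; apply; apply: off;
  by rewrite /= ltnS ik' leqnn.
Qed.

(** * The four regions of a crossing *)

Section Crossing.
Variable e : E.

(** The two strands of e cannot exchange their roles, as i1 < i2, and each strand
    determines its two ends. *)
Lemma crossing_unique i1 i2 j1 j2 i1' i2' j1' j2' :
  crossing_ends e i1 i2 j1 j2 -> crossing_ends e i1' i2' j1' j2' ->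
  [/\ i1 = i1', i2 = i2', j1 = j1' & j2 = j2'].
Proof.
have ends_unique b i j i' j' : strand_ends (strand_at e b) i j -> (i < j)%N ->
    strand_ends (strand_at e b) i' j' -> (i' < j')%N -> i = i' /\ j = j'.
  move=> ends ij ends' ij'.
  have := strand_end_mem i ends'; have := strand_end_mem j ends'.
  rewrite !(strand_end_mem _ ends) !eqxx orbT => /esym /pred2P eq_j /esym /pred2P eq_i.
  by case: eq_i eq_j ij => -> [] -> //; rewrite ?ltnn // => /(ltn_trans ij'); rewrite ltnn.
case/and4P=> i12 i2j1 j12 ends /and4P [i12' i2j1' j12' ends'].
have ij1 := ltn_trans i12 i2j1; have ij2 := ltn_trans i2j1 j12.
have ij1' := ltn_trans i12' i2j1'; have ij2' := ltn_trans i2j1' j12'.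
case/orP: ends => /andP [ends1 ends2]; case/orP: ends' => /andP [ends1' ends2'].
- have [-> ->] := ends_unique false _ _ _ _ ends1 ij1 ends1' ij1'.
  by have [-> ->] := ends_unique true _ _ _ _ ends2 ij2 ends2' ij2'.
- have [eq_i _] := ends_unique false _ _ _ _ ends1 ij1 ends2' ij2'.
  have [eq_i' _] := ends_unique true _ _ _ _ ends2 ij2 ends1' ij1'.
  by move: i12; rewrite eq_i eq_i' ltnNge ltnW.
- have [eq_i _] := ends_unique true _ _ _ _ ends1 ij1 ends2' ij2'.
  have [eq_i' _] := ends_unique false _ _ _ _ ends2 ij2 ends1' ij1'.
  by move: i12; rewrite eq_i eq_i' ltnNge ltnW.
- have [-> ->] := ends_unique true _ _ _ _ ends1 ij1 ends1' ij1'.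
  by have [-> ->] := ends_unique false _ _ _ _ ends2 ij2 ends2' ij2'.
Qed.

Definition cell_around (C : cell G) :=
  exists s, same_region e C (endpoint e s) \/ same_region e C (side_face e s).

Lemma stub_around b k s : connect (off_rel e) (inl (e, s), b) (stub_dart G k) ->
  cell_around (arc_cell G k).
Proof.
move/ray_sides; rewrite /same_sides -stub_medial !vertex_medial !face_medial.
rewrite /cell_around /= ![same_region e (vertex_at (inl _)) _]same_region_sym.
by case: (arc_cell_sides G k) => ->; case=> -[h1 h2];
  [exists s; left | exists (if b then ~~ s else s); right |
   exists (if b then ~~ s else s); right | exists s; left];
  rewrite // /same_region same_region_sym.
Qed.

Definition region_coloring (chi : bool -> cell G -> bool) :=
  forall b x, chi b (vertex_at x) (+) chi b (face_at x) = (x \in strand_at e b).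

Lemma region_coloring_exists : exists chi, region_coloring chi.
Proof.
have col b : exists chi : cell G -> bool,
    forall x, chi (vertex_at x) (+) chi (face_at x) = (x \in strand_at e b).
  apply: strand_coloring => [e' s b'|]; first by rewrite !mem_strand_at.
  by have [k [ne_k _ /eqP ->]] := two_ends G_min e b; rewrite cards2 ne_k.
have [chi0 chi0E] := col false; have [chi1 chi1E] := col true.
by exists (fun b => if b then chi1 else chi0) => -[].
Qed.

Lemma coloring_around chi s b c : region_coloring chi ->
  chi b (side_face e s) = chi b (endpoint e (c (+) s)) (+) (c == b).
Proof.
move=> chiE; have := chiE b (medial (inl (e, c (+) s), c)).
rewrite vertex_medial face_medial mem_strand_at (inj_eq (@strand_at_inj _ _ _ G_min e)).
rewrite (_ : (if c then _ else _) = s); last by case: (c); rewrite ?addTb ?negbK.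
by move=> <-; rewrite addKb.
Qed.

Lemma coloring_opposite chi b s : region_coloring chi ->
  chi b (endpoint e (~~ s)) = ~~ chi b (endpoint e s).
Proof.
move=> chiE; have := coloring_around s b false chiE.
have := coloring_around s b true chiE => /= ->.
by case: b; case: (chi _ _); case: (chi _ _).
Qed.

(** The ray does not cross the other strand of e, so it stays on the side of that
    strand on which it starts. *)
Lemma stub_color chi b s k : region_coloring chi ->
  connect (off_rel e) (inl (e, s), ~~ b) (stub_dart G k) ->
  chi b (arc_cell G k) = chi b (endpoint e s).
Proof.
move=> chiE /ray_sides; rewrite /same_sides -stub_medial !vertex_medial !face_medial /=.
set f := side_face _ _ => sides.
have fE : chi b f = chi b (endpoint e s).
  rewrite /f (coloring_around _ _ (~~ b) chiE); case: (b) => /=; rewrite ?addbF ?negbK //.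
have eqE C D : same_region e C D -> chi b C = chi b D by apply: coloring_region (chiE b).
by case: (arc_cell_sides G k) sides => -> [] [] /eqE h1 /eqE h2;
  rewrite -?h1 -?h2 ?fE.
Qed.

(** Let i < j be the ends of one strand of e.  The rays of the other strand leave e
    on different sides of the first strand and stay there, so exactly one of
    the ends of the other strand lies between i and j.  From i1 to j1 one passes
    exactly one end of each strand, i2 and j1, so both colours change. *)
Lemma crossing_arcs : exists i1 i2 j1 j2,
  [/\ crossing_ends e i1 i2 j1 j2, cell_around (arc_cell G i1), cell_around (arc_cell G j1) &
      forall chi, region_coloring chi ->
        forall b, chi b (arc_cell G j1) = ~~ chi b (arc_cell G i1)].
Proof.
have ends b : exists p : 'I_(n.*2) * 'I_(n.*2), exists s,
    [/\ (p.1 < p.2)%N, strand_ends (strand_at e b) p.1 p.2,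
    connect (off_rel e) (inl (e, s), b) (stub_dart G p.1) &
    connect (off_rel e) (inl (e, ~~ s), b) (stub_dart G p.2)].
  have [k [ne_k conn_k ends_k]] := two_ends G_min e b.
  have: (k false < k true)%N || (k true < k false)%N by rewrite -neq_ltn.
  case/orP => lt_k; first by exists (k false, k true), false.
  by exists (k true, k false), true; split=> //; rewrite /strand_ends setUC.
have [p /fin_all_exists [s stubs]] := fin_all_exists ends.
have arcE chi b : region_coloring chi ->
    exists c, forall k, chi b (arc_cell G k) = c (+) ((p b).1 <= k < (p b).2)%N.
  by move=> chiE; have [lt_p ends_p _ _] := stubs b; apply: arc_coloring ends_p lt_p (chiE b).
have [chi chiE] := region_coloring_exists.
have interlaced b : ((p b).1 <= (p (~~ b)).1 < (p b).2)%N !=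
    ((p b).1 <= (p (~~ b)).2 < (p b).2)%N.
  have [_ _ conn1 conn2] := stubs (~~ b); have [c cE] := arcE chi b chiE.
  have := stub_color chiE conn1; have := stub_color chiE conn2.
  rewrite coloring_opposite // !cE => h2 h1; apply/eqP => eq_p.
  by move: h1; rewrite eq_p h2; case: (chi _ _).
have ne_ends b : ((p b).1 != (p (~~ b)).1) && ((p b).2 != (p (~~ b)).2).
  have [_ ends_b _ _] := stubs b; have [_ ends_b' _ _] := stubs (~~ b).
  have neq := strand_at_neq G_min e b.
  have mem_end c k : (k == (p c).1) || (k == (p c).2) -> strand (stub G k) = strand_at e c.
    have [_ ends_c _ _] := stubs c.
    by rewrite -(strand_end_mem _ ends_c) mem_strand => /eqP.
  by apply/andP; split; apply: contraNneq neq => eq_k;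
     [rewrite -(mem_end b (p b).1) | rewrite -(mem_end b (p b).2)];
     rewrite ?eqxx ?orbT // eq_k (mem_end (~~ b)) ?eqxx ?orbT.
have {interlaced} crossing b : ((p b).1 < (p (~~ b)).1)%N ->
    ((p (~~ b)).1 < (p b).2 < (p (~~ b)).2)%N.
  have [lt_b _ _ _] := stubs b; have [lt_b' _ _ _] := stubs (~~ b).
  have := interlaced b; have /andP [_] := ne_ends b; rewrite -val_eqE /=.
  by clear -lt_b lt_b'; lia.
have [b lt_i] : exists b, ((p b).1 < (p (~~ b)).1)%N.
  have /andP [+ _] := ne_ends false; rewrite -val_eqE neq_ltn => /orP [] lt_i.
    by exists false.
  by exists true.
have /andP [lt_ij lt_j] := crossing b lt_i.
have [_ ends_b conn1 conn2] := stubs b; have [lt_b' ends_b' _ _] := stubs (~~ b).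
exists (p b).1, (p (~~ b)).1, (p b).2, (p (~~ b)).2; split.
- rewrite /crossing_ends lt_i lt_ij lt_j.
  by case: (b) ends_b ends_b' => /= eb eb'; apply/orP; [right|left]; apply/andP.
- exact: stub_around conn1.
- exact: stub_around conn2.
move=> chi' chi'E b0; have [c cE] := arcE chi' b0 chi'E; rewrite !cE.
have [->|ne_b] := eqVneq b0 b.
  by rewrite ltnn andbF leqnn (ltn_trans lt_i lt_ij) addbF addbT negbK.
have -> : b0 = ~~ b by case: (b) (b0) ne_b => -[].
by rewrite lt_j (ltnW lt_ij) (leqNgt (p (~~ b)).1) lt_i addbT addbF.
Qed.

(** Around e one crosses the two strands alternately, so that the four cells get the
    four different pairs of colours. *)
Lemma color_cells chi : region_coloring chi -> exists2 p,
  (forall b s, chi b (endpoint e s) = s (+) p b) &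
  (forall b s, chi b (side_face e s) = s (+) p b (+) ~~ b).
Proof.
move=> chiE; have color_end b s : chi b (endpoint e s) = s (+) chi b (endpoint e false).
  by case: s => //; rewrite -[in LHS]/(~~ false) coloring_opposite.
exists (fun b => chi b (endpoint e false)) => b s; first exact: color_end.
by rewrite (coloring_around s b false) // color_end; case: b.
Qed.

(** C is in the region of a cell around e with the same colours as D; by
    [color_cells] that cell is D. *)
Lemma region_by_color chi C D : region_coloring chi -> cell_around C ->
  (exists s, D = endpoint e s \/ D = side_face e s) ->
  same_region e C D = (chi false C == chi false D) && (chi true C == chi true D).
Proof.
move=> chiE around_C around_D; apply/idP/andP => [CD|[]].
  by split; apply/eqP; apply: coloring_region (chiE _) CD.
have [p color_end color_side] := color_cells chiE.
case: around_C => s0 around_C; case: around_D => s around_D.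
have eqC q b : same_region e C q -> chi b C = chi b q.
  by apply: coloring_region (chiE b).
case: around_C => CD; rewrite !(eqC _ _ CD); case: around_D => ->;
  rewrite !(color_end, color_side); move: CD;
  by case: s0; case: s; case: (p false); case: (p true).
Qed.

(** No strand of e ends strictly between the stubs i and j, so all the cells of this
    part of the boundary lie in the same region. *)
Lemma beside_arcE (i j : 'I_(n.*2)) (C : cell G) : (i < j)%N ->
  (forall m : 'I_(n.*2), (i < m < j)%N -> forall b, stub G m \notin strand_at e b) ->
  beside_arc e i j C = same_region e (arc_cell G i) C.
Proof.
move=> lt_ij off; apply/forallP/idP => [/(_ i)|iC k]; first by rewrite leqnn lt_ij.
apply/implyP => /andP [ik kj]; apply: same_region_trans iC.
rewrite /same_region same_region_sym; apply: arcs_region => // m /andP [im mk].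
by apply: off; rewrite im (leq_ltn_trans mk).
Qed.

Lemma crossing_stubs i1 i2 j1 j2 (m : 'I_(n.*2)) b : crossing_ends e i1 i2 j1 j2 ->
  stub G m \in strand_at e b -> m \in [:: i1; i2; j1; j2].
Proof.
move=> ends_e m_b.
have m_end i j : strand_ends (strand_at e b) i j ->
    i \in [:: i1; i2; j1; j2] -> j \in [:: i1; i2; j1; j2] -> m \in [:: i1; i2; j1; j2].
  by move=> ends; move: m_b; rewrite (strand_end_mem m ends) => /orP [] /eqP ->.
case/and4P: ends_e => _ _ _ /orP [] /andP [ends_i ends_j]; case: (b) m_end => m_end.
- by apply: (m_end _ _ ends_j); rewrite !inE eqxx ?orbT.
- by apply: (m_end _ _ ends_i); rewrite !inE eqxx ?orbT.
- by apply: (m_end _ _ ends_i); rewrite !inE eqxx ?orbT.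
- by apply: (m_end _ _ ends_j); rewrite !inE eqxx ?orbT.
Qed.

Lemma region_arcE i1 i2 j1 j2 C : crossing_ends e i1 i2 j1 j2 ->
  (C \in left_region e) = same_region e (arc_cell G i1) C /\
  (C \in right_region e) = same_region e (arc_cell G j1) C.
Proof.
move=> ends.
have off (m : 'I_(n.*2)) : (i1 < m < i2)%N || (j1 < m < j2)%N ->
    forall b, stub G m \notin strand_at e b.
  move=> lt_m b; apply/negP => /(crossing_stubs ends).
  case/and4P: ends => lt1 lt2 lt3 _; rewrite !inE -!val_eqE /=.
  by clear -lt_m lt1 lt2 lt3; lia.
have [lt1 _ lt3 _] := and4P ends.
rewrite -(@beside_arcE i1 i2) // => [|m lt_m]; last by apply: off; rewrite lt_m.
rewrite -(@beside_arcE j1 j2) // => [|m lt_m]; last by apply: off; rewrite lt_m orbT.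
split; rewrite inE; apply/existsP/idP.
- case=> i1' /existsP [i2' /existsP [j1' /existsP [j2' /andP [ends' +]]]].
  by have [-> -> _ _] := crossing_unique ends' ends.
- move=> beside; exists i1; apply/existsP; exists i2; apply/existsP; exists j1.
  by apply/existsP; exists j2; rewrite ends.
- case=> i1' /existsP [i2' /existsP [j1' /existsP [j2' /andP [ends' +]]]].
  by have [_ _ -> ->] := crossing_unique ends' ends.
- move=> beside; exists i1; apply/existsP; exists i2; apply/existsP; exists j1.
  by apply/existsP; exists j2; rewrite ends.
Qed.

(** The cell at the stub i1 is in the region of one of the four cells around e.
    If this is an endpoint, the other endpoint has both colours
    changed, as has the cell at the stub j1. *)
Lemma crossing_factor :
  let K C := if C \in left_region e then horizontal_cond e else 1 in
  K (endpoint e false) * K (endpoint e true) =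
  cond e * (K (side_face e false) * K (side_face e true)).
Proof.
have [i1 [i2 [j1 [j2 [ends around_i around_j opposite]]]]] := crossing_arcs.
have [chi chiE] := region_coloring_exists; have [p color_end color_side] := color_cells chiE.
pose a b := chi b (arc_cell G i1).
have left_end s : (endpoint e s \in left_region e) =
    (a false == s (+) p false) && (a true == s (+) p true).
  rewrite (region_arcE _ ends).1 (region_by_color chiE) ?color_end //.
  by exists s; left.
have left_side s : (side_face e s \in left_region e) =
    (a false == s (+) p false (+) true) && (a true == s (+) p true (+) false).
  rewrite (region_arcE _ ends).1 (region_by_color chiE) ?color_side //.
  by exists s; right.
have left_right s : (endpoint e s \in left_region e) && (endpoint e (~~ s) \in right_region e) =
    (a false == s (+) p false) && (a true == s (+) p true).
  rewrite left_end [X in _ && X](region_arcE _ ends).2 [X in _ && X](region_by_color chiE) //.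
    rewrite ![in X in _ && X]opposite // ![in X in _ && X]color_end -/(a false) -/(a true).
    by case: s; case: (a false); case: (a true); case: (p false); case: (p true).
  by exists (~~ s); left.
have horE : horizontal_cond e =
    if (a false == p false) && (a true == p true) || (a false != p false) && (a true != p true)
    then cond e else (cond e)^-1.
  rewrite /horizontal_cond; congr (if _ then _ else _); under eq_existsb do rewrite left_right.
  have -> (F : pred bool) : [exists b, F b] = F false || F true.
    by apply/existsP/orP => [[[]]|[]]; [right | left | exists false | exists true].
  by case: (a false); case: (a true); case: (p false); case: (p true).
rewrite /= horE (left_end false) (left_end true) (left_side false) (left_side true).
have c_neq0 : cond e != 0 by rewrite lt0r_neq0 ?cond_gt0.
by case: (a false); case: (a true); case: (p false); case: (p true);
  rewrite /= ?mul1r ?mulr1 ?mulfV.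
Qed.

End Crossing.

Lemma B_neq0 (C : cell G) : B C != 0.
Proof.
apply/prodf_neq0 => e _; rewrite /horizontal_cond.
by case: ifP => _; rewrite ?invr_eq0 lt0r_neq0 ?cond_gt0.
Qed.

Lemma left_region_same (e : E) (C D : cell G) : same_region e C D ->
  (C \in left_region e) = (D \in left_region e).
Proof.
move=> CD; have [i1 [i2 [j1 [j2 [ends _ _ _]]]]] := crossing_arcs e.
rewrite !(region_arcE _ ends).1.
by apply: (same_connect_r (@same_region_sym e)).
Qed.
End MinimalNetwork.

Theorem proposition3p3 (R : realFieldType) (n : nat) (G : network R n)
  (G_minimal : minimal G) (e : edge G) :
  cond e = (B (endpoint e false) * B (endpoint e true))
           / (B (side_face e false) * B (side_face e true)).
Proof.
apply/esym/(canLR (mulfK _)); first by rewrite mulf_neq0 ?B_neq0.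
have BE C : B C = \prod_(e' : edge G) (if C \in left_region e' then horizontal_cond e' else 1).
  exact: big_mkcond.
rewrite !BE -!big_split.
rewrite (bigD1 e) //= [in RHS](bigD1 e) //= mulrA crossing_factor //.
congr (_ * _); apply: eq_bigr => e' ne.
rewrite eq_sym in ne; have [c cells] := cells_paired G_minimal ne.
rewrite !(left_region_same G_minimal (cells _)).
by case: (c) => //=; rewrite mulrC.
Qed.
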